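(* Let $q$ be a prime power and let $\mathcal V=\{V_1,\dots,V_k\}$ be a collection of subspaces of $GF(q)^n$. Then the array $OA(\mathcal V)$ is an orthogonal array of strength $t$ if and only if $\mathcal V$ is a mixed spread of strength $t$.
   Context: A collection $\mathcal V=\{V_1,\dots,V_k\}$ of subspaces of $GF(q)^n$ is a mixed spread of strength $t$ if for every choice of $\tau\le t$ indices $1\le i_1<\cdots<i_\tau\le k$ the dimension (over $GF(q)$) of the span of $V_{i_1},\dots,V_{i_\tau}$ equals $\dim V_{i_1}+\cdots+\dim V_{i_\tau}$. For each $i$, fix a labeling $f_0,f_1,\dots,f_{q^{\dim V_i}-1}$ of the dual space $V_i^*$ of linear functionals on $V_i$. The array $OA(\mathcal V)$ has $q^n$ rows indexed by the linear functionals $f$ on $GF(q)^n$ and $k$ columns indexed by $V_1,\dots,V_k$; its $(f,V_i)$ entry is $j$ where $f|_{V_i}$ is the $j$-th functional in the labeling of $V_i^*$; so column $i$ has symbols from $\{0,\dots,q^{\dim V_i}-1\}$. An $N\times k$ array whose $i$-th column has symbols from a set of size $s_i$ is an orthogonal array of strength $t$ if in every $N\times t$ subarray every possible $t$-tuple of symbols occurs equally often as a row.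
   Formalization: The formal theorem assumes t ≤ k; for t > k there are no N×t subarrays, so the orthogonal array condition is vacuous and the equivalence fails (e.g. k = 2, V_1 = V_2 ≠ 0, t = 3). *)

(* Defs.v *)
From HB Require Import structures.
From mathcomp Require Import all_boot all_order all_algebra all_field.

Set Implicit Arguments.
Unset Strict Implicit.
Unset Printing Implicit Defensive.

Import GRing.Theory.
Local Open Scope ring_scope.

(* Strictly increasing selections [c : 'I_tau -> 'I_k] encode the index choices
   i_1 < ... < i_tau. *)
Definition increasing_sel (tau k : nat) (c : 'I_tau -> 'I_k) : Prop :=
  forall i j : 'I_tau, (i < j)%N -> (c i < c j)%N.

Definition mixed_spread (F : fieldType) (n k : nat)
    (V : 'I_k -> {vspace 'rV[F]_n}) (t : nat) : Prop :=
  forall tau : nat, (tau <= t)%N ->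
  forall c : 'I_tau -> 'I_k, increasing_sel c ->
    \dim (\sum_(j < tau) V (c j))%VS = (\sum_(j < tau) \dim (V (c j)))%N.

(* Rows are indexed by an arbitrary finite type; column [i] has its symbols in
   {0, ..., s i - 1}. *)
Definition mixed_array (row : finType) (k : nat) (s : 'I_k -> nat) : Type :=
  row -> forall i : 'I_k, 'I_(s i).

Definition orthogonal_array (row : finType) (k : nat) (s : 'I_k -> nat)
    (A : mixed_array row s) (t : nat) : Prop :=
  forall c : 'I_t -> 'I_k, increasing_sel c ->
  exists lambda : nat, forall x : (forall j : 'I_t, 'I_(s (c j))),
    #|[set r : row | [forall j : 'I_t, A r (c j) == x j]]| = lambda.

Section SpreadArray.

Variables (F : finFieldType) (n k : nat) (V : 'I_k -> {vspace 'rV[F]_n}).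

(* [finvect_type] only equips the space of functionals with its finType
   structure. *)
Definition functional : finType := finvect_type 'Hom('rV[F]_n, F^o).

Definition subdual (i : 'I_k) := 'Hom(subvs_of (V i), F^o).

Definition restrict (f : 'Hom('rV[F]_n, F^o)) (i : 'I_k) : subdual i :=
  (f \o linfun (vsval : subvs_of (V i) -> 'rV[F]_n))%VF.

Definition nsymb (i : 'I_k) : nat := (#|F| ^ \dim (V i))%N.

Definition OA (lab : forall i : 'I_k, subdual i -> 'I_(nsymb i)) :
    mixed_array functional nsymb :=
  fun f i => lab i (restrict f i).

End SpreadArray.

(* Main.v *)
Require Import Defs.
From mathcomp Require Import all_boot all_order all_algebra all_field.

(** A family of subspaces is in direct sum exactly when every family of
    functionals on its members extends to a common functional on the whole
    space.  The restriction map is linear, so all its nonempty fibres have the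
    same size; since the fibre of the zero functional is nonempty, the array has
    constant multiplicities on given columns iff the restriction map to these
    columns is onto, that is, iff the corresponding sum of subspaces is direct. *)

Set Implicit Arguments.
Unset Strict Implicit.
Unset Printing Implicit Defensive.

Import GRing.Theory.
Local Open Scope ring_scope.

Lemma exists_superset_card (T : finType) (A : {set T}) (m : nat) :
  (#|A| <= m <= #|T|)%N -> exists2 B : {set T}, A \subset B & #|B| = m.
Proof.
elim: m => [|m IHm] /andP[leAm lemT].
  by exists A => //; apply/eqP; rewrite -leqn0.
move: leAm; rewrite leq_eqVlt => /predU1P[<-|leAm]; first by exists A.
have [|B sAB cardB] := IHm; first by rewrite -ltnS leAm ltnW.
have /set0Pn[x] : ~: B != set0.
  by rewrite -card_gt0 cardsCs setCK cardB subn_gt0.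
rewrite inE => notBx; exists (x |: B); first exact: subset_trans (subsetU1 _ _).
by rewrite cardsU1 notBx cardB.
Qed.

Lemma increasing_sel_inj (m k : nat) (c : 'I_m -> 'I_k) :
  increasing_sel c -> injective c.
Proof.
move=> inc_c i j eq_c; apply: val_inj => /=.
by case: (ltngtP i j) => // /inc_c; rewrite eq_c ltnn.
Qed.

Lemma increasing_sel_enum_val (k m : nat) (B : {set 'I_k}) (eqm : m = #|B|) :
  increasing_sel (fun j : 'I_m => enum_val (cast_ord eqm j)).
Proof.
move=> i j ltij; have x0 : 'I_k := enum_val (cast_ord eqm i).
rewrite !(enum_val_nth x0) /=.
(* [enum B] is a filtered copy of the enumeration of ['I_k], whose values are 0, ..., k - 1 in
   order. *)
have srt : sorted (relpre val ltn) (enum B).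
  rewrite -sorted_map.
  apply: (subseq_sorted ltn_trans (map_subseq _ (filter_subseq _ _))).
  by rewrite -enumT val_enum_ord iota_ltn_sorted.
have lttr : transitive (relpre (@nat_of_ord k) ltn).
  by move=> ? ? ?; apply: ltn_trans.
by apply: (sorted_ltn_nth lttr x0 srt); rewrite ?inE -?cardE -?eqm.
Qed.

(** Bridges the two definitions: an array is tested on exactly [t] columns, a spread on at most [t].
    The image of [c] is enlarged to a set of [t] indices, [d] lists it in increasing order, and
    [h j] is the rank of [c j] in it. *)
Lemma increasing_sel_extend (m t k : nat) (c : 'I_m -> 'I_k) :
  increasing_sel c -> (m <= t <= k)%N ->
  exists (d : 'I_t -> 'I_k) (h : 'I_m -> 'I_t),
    [/\ increasing_sel d, injective h & forall j, c j = d (h j)].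
Proof.
move=> inc_c lemtk; have inj_c := increasing_sel_inj inc_c.
have [|B sAB cardB] := @exists_superset_card _ [set c j | j in 'I_m] t.
  by rewrite card_imset // !card_ord.
have Bc j : c j \in B by apply: (subsetP sAB); apply: imset_f.
pose h j := cast_ord cardB (enum_rank_in (Bc j) (c j)).
have dh j : c j = enum_val (cast_ord (esym cardB) (h j)).
  by rewrite cast_ordK enum_rankK_in.
exists (fun j => enum_val (cast_ord (esym cardB) j)), h; split => //.
  exact: increasing_sel_enum_val.
by move=> i j eq_h; apply: inj_c; rewrite !dh eq_h.
Qed.

Section DirectSums.

Variables (K : fieldType) (vT : vectType K) (I : finType).
Variable Vs : I -> {vspace vT}.

Lemma directv_sub_family (J : finType) (h : J -> I) :
  injective h -> directv (\sum_i Vs i) -> directv (\sum_j Vs (h j)).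
Proof.
move=> inj_h /directv_sum_independent dirV.
apply/directv_sum_independent => us Vus sum0 j _.
(* Extends [us] by zero outside the image of [h]; by injectivity each of these sums has at most one
   term. *)
pose w i := \sum_(j | h j == i) us j.
have wE : w (h j) = us j.
  by rewrite /w (big_pred1 j) // => l; rewrite (inj_eq inj_h).
rewrite -wE; apply: dirV => // [i _|].
  by apply: memv_suml => l /eqP <-; apply: Vus.
by rewrite -[RHS]sum0 [RHS](partition_big h predT).
Qed.

Lemma directv_extend (wT : vectType K)
    (g : forall i, 'Hom(subvs_of (Vs i), wT)) :
  directv (\sum_i Vs i) ->
  exists f : 'Hom(vT, wT), forall i (v : subvs_of (Vs i)), f (vsval v) = g i v.
Proof.
(* The extension is the sum over [i] of [g i] after the projection to the [i]-th summand. *)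
move=> dirV; pose p i := sumv_pi (\sum_i Vs i)%VS i.
exists (\sum_i (g i \o (linfun (vsproj (Vs i)) \o p i)))%VF => i v.
have pE l : p l (vsval v) = if l == i then vsval v else 0.
  have Vv : vsval v \in (\sum_i Vs i)%VS.
    exact: (subvP (sumv_sup i (isT : xpredT i) (subvv (Vs i)))) (subvsP v).
  (* Two decompositions of [vsval v] are compared: its projections, and the family concentrated at
     [i]. Directness makes them agree termwise. *)
  have /directv_sum_unique/(_ (fun l => p l (vsval v))) := dirV.
  move/(_ (fun l => if l == i then vsval v else 0)).
  rewrite sumv_pi_sum // -big_mkcond big_pred1_eq eqxx => eqs.
  apply/eqP; move: l; apply/forallP; rewrite -eqs //= => l _.
    exact: memv_sum_pi.
  by case: eqP => [->|_]; rewrite ?subvsP ?mem0v.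
rewrite sum_lfunE (bigD1 i) //= big1 ?addr0 => [|l ne_li].
  by rewrite !comp_lfunE pE eqxx lfunE /= vsvalK.
by rewrite !comp_lfunE pE (negPf ne_li) !linear0.
Qed.

(* A nontrivial relation is ruled out by extending a functional that is nonzero
   on one of its terms together with zero on the other subspaces. *)
Lemma extend_directv :
  (forall g : (forall i, 'Hom(subvs_of (Vs i), K^o)),
     exists f : 'Hom(vT, K^o),
       forall i (v : subvs_of (Vs i)), f (vsval v) = g i v) ->
  directv (\sum_i Vs i).
Proof.
move=> ext; apply/directv_sum_independent => us Vus sum0 i _.
apply/eqP/negPn/negP => nz_ui.
have [phi phi_nz] : exists phi : 'Hom(vT, K^o), phi (us i) != 0.
  have /forallPn[l nzl] : ~~ [forall l, coord (vbasis fullv) l (us i) == 0].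
    apply: contra nz_ui => /forallP z.
    rewrite (coord_vbasis (memvf (us i))) big1 // => l _.
    by rewrite (eqP (z l)) scale0r.
  exists (linfun (coord (vbasis fullv) l : vT -> K^o)).
  by rewrite lfunE.
pose psi l : 'Hom(vT, K^o) := if l == i then phi else 0.
have [f fE] := ext (fun l =>
  psi l \o linfun (vsval : subvs_of (Vs l) -> vT))%VF.
have fus l : f (us l) = psi l (us l).
  have := fE l (vsproj (Vs l) (us l)).
  by rewrite comp_lfunE lfunE /= vsprojK // Vus.
case/eqP: phi_nz; rewrite -[RHS](linear0 f) -sum0 linear_sum (bigD1 i) //=.
rewrite big1 ?addr0 => [|l ne_li]; first by rewrite fus /psi eqxx.
by rewrite fus /psi (negPf ne_li) lfunE.
Qed.

End DirectSums.

Section SpreadArrays.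

Variables (F : finFieldType) (n k : nat) (V : 'I_k -> {vspace 'rV[F]_n}).

Lemma restrictE (f : 'Hom('rV[F]_n, F^o)) i (v : subvs_of (V i)) :
  restrict V f i v = f (vsval v).
Proof. by rewrite /restrict comp_lfunE lfunE. Qed.

Lemma mixed_spreadP (t : nat) :
  mixed_spread V t <->
  forall m, (m <= t)%N -> forall c : 'I_m -> 'I_k, increasing_sel c ->
    directv (\sum_j V (c j)).
Proof.
split=> spV m lemt c inc_c; have := spV m lemt c inc_c.
  by move=> eq_dim; rewrite directvE /= eq_dim.
by rewrite directvE /= => /eqP.
Qed.

Variable lab : forall i : 'I_k, subdual V i -> 'I_(nsymb V i).
Hypothesis lab_bij : forall i, bijective (@lab i).

(** If [f] lies in the fibre of [x], translation by [g - f] injects that fibre into the fibre of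
    [y]. Injectivity of the labelings turns equal symbols into equal restrictions. *)
Lemma fibre_card_le (m : nat) (c : 'I_m -> 'I_k)
    (x y : forall j, 'I_(nsymb V (c j))) (g : functional F n) :
  (forall j, OA lab g (c j) = y j) ->
  (#|[set r : functional F n | [forall j, OA lab r (c j) == x j]]| <=
   #|[set r : functional F n | [forall j, OA lab r (c j) == y j]]|)%N.
Proof.
move=> gy.
set A := [set r | _]; have [->|/set0Pn[f]] := eqVneq A set0.
  by rewrite cards0.
rewrite inE => /forallP fx.
pose tau (r : functional F n) : functional F n :=
  (r : 'Hom('rV[F]_n, F^o)) + (g - f : 'Hom('rV[F]_n, F^o)).
have inj_tau : injective tau by move=> r s /addIr.
rewrite -(card_imset _ inj_tau); apply/subset_leq_card/subsetP => _ /imsetP[r + ->].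
rewrite !inE => /forallP rx; apply/forallP => j; rewrite -gy /OA.
apply/eqP; congr (lab _); apply/lfunP => v; rewrite !restrictE.
have /(bij_inj (lab_bij _))/lfunP/(_ v) : lab (restrict V r (c j)) = lab (restrict V f (c j)).
  by rewrite [LHS](eqP (rx j)) [RHS](eqP (fx j)).
by rewrite !restrictE /tau add_lfunE add_lfunE opp_lfunE => ->; rewrite addrC subrK.
Qed.

Lemma OA_columns_directv (m : nat) (c : 'I_m -> 'I_k) :
  (exists lambda, forall x : (forall j, 'I_(nsymb V (c j))),
    #|[set r : functional F n | [forall j, OA lab r (c j) == x j]]| = lambda)
  <-> directv (\sum_j V (c j)).
Proof.
split=> [[lambda cardE] | dirV].
  apply: extend_directv => g.
  (* The row of the zero functional shows [lambda] to be positive, so the tuple of labels of [g]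
     occurs as well. *)
  pose x0 j := OA lab (0 : 'Hom('rV[F]_n, F^o)) (c j).
  have : (0 < #|[set r : functional F n | [forall j, OA lab r (c j) == x0 j]]|)%N.
    by apply/card_gt0P; exists (0 : 'Hom('rV[F]_n, F^o)); rewrite inE; apply/forallP.
  rewrite cardE -(cardE (fun j => lab (g j : subdual V (c j)))) => /card_gt0P[f].
  rewrite inE => /forallP fg; exists f => j v.
  by rewrite -restrictE (bij_inj (lab_bij _) (eqP (fg j))).
have onto (x : forall j, 'I_(nsymb V (c j))) :
    exists f : functional F n, forall j, OA lab f (c j) = x j.
  (* Stated with a boolean equality so that [xchoose] can pick the preimages for all [j] at once. *)
  have ex_g j : exists g : subdual V (c j), lab g == x j.
    by have [lab' _ labK] := lab_bij (c j); exists (lab' (x j)); rewrite labK.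
  have [f fE] := directv_extend (fun j => xchoose (ex_g j)) dirV.
  exists f => j; rewrite /OA -[RHS](eqP (xchooseP (ex_g j))).
  by congr (lab _); apply/lfunP => v; rewrite restrictE fE.
(* Any tuple could serve as reference for [lambda]: all fibres are now nonempty, so the inequality
   applies in both directions. *)
pose x0 j := OA lab (0 : 'Hom('rV[F]_n, F^o)) (c j).
exists #|[set r : functional F n | [forall j, OA lab r (c j) == x0 j]]| => x.
have [f fx] := onto x; have [f0 fx0] := onto x0.
by apply/eqP; rewrite eqn_leq (fibre_card_le _ fx0) (fibre_card_le _ fx).
Qed.

End SpreadArrays.

(** For [t > k] no increasing selection of [t] columns exists and the array condition would be
    vacuous, while shorter selections still constrain the spread; [t_le_k] excludes this. *)
Theorem theorem5 (F : finFieldType) (n k t : nat)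
    (V : 'I_k -> {vspace 'rV[F]_n})
    (lab : forall i : 'I_k, subdual V i -> 'I_(nsymb V i))
    (lab_bij : forall i : 'I_k, bijective (lab i))
    (t_le_k : (t <= k)%N) :
  orthogonal_array (OA lab) t <-> mixed_spread V t.
Proof.
split=> [oaV | /mixed_spreadP dirV c inc_c].
  apply/mixed_spreadP => m lemt c inc_c.
  have [|d [h [inc_d inj_h ch]]] := increasing_sel_extend (t := t) inc_c.
    by rewrite lemt.
  have /(OA_columns_directv lab_bij) dirV := oaV d inc_d.
  have := directv_sub_family inj_h dirV.
  (* [ch] is only a pointwise equality, so directness is unfolded to an equation of dimensions whose
     two sums are rewritten term by term. *)
  by rewrite !directvE /= -(eq_bigr _ (fun j _ => congr1 V (ch j)))
     -(eq_bigr _ (fun j _ => congr1 (fun i => \dim (V i)) (ch j))).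
exact/(OA_columns_directv lab_bij)/dirV.
Qed.
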